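(* Let $(M,H,\omega)$ be an almost hypercomplex skew-Hermitian manifold of dimension $4n$, $n>1$, with canonical connection $\nabla^{H,\omega}$. Then $H$ is hypercomplex (i.e. the three almost complex structures of $H$ are integrable) and $\omega$ is symplectic (i.e. $d\omega=0$) if and only if $(H,\omega)$ is of mixed type $\mathcal{X}_{57}$, that is, the torsion of $\nabla^{H,\omega}$ is contained in the submodule $\mathcal{X}_5\oplus\mathcal{X}_7=[S^3_0\mathsf{E}\,\mathsf{H}]^*\oplus[\mathsf{E}\mathsf{H}]^*$.
   Context: $M$ is a connected smooth $4n$-manifold, $n>1$. An almost hypercomplex structure is a triple $H=\{J_1,J_2,J_3\}$ of almost complex structures with $J_1J_2=-J_2J_1=J_3$. A scalar 2-form with respect to $H$ is a non-degenerate 2-form $\omega$ with $\omega(J_aX,J_aY)=\omega(X,Y)$, $a=1,2,3$; then $(H,\omega)$ is an almost hypercomplex skew-Hermitian structure (equivalently an $\mathsf{SO}^*(2n)$-structure). Modules (for $\mathsf{SO}^*(2n)\mathsf{Sp}(1)$): $\mathsf{E}=\mathbb{C}^{2n}$, $\mathsf{H}=\mathbb{C}^2$ are the standard representations of $\mathsf{SO}^*(2n)$, $\mathsf{Sp}(1)$; $[\,\cdot\,]$ denotes the real form; $T_xM\cong[\mathsf{EH}]$. $\mathsf{E}$ carries an invariant complex symmetric form; $S^k_0\mathsf{E}$ denotes trace-free symmetric tensors. $\mathsf{E}\otimes\Lambda^2\mathsf{E}=\Lambda^3\mathsf{E}\oplus\mathsf{K}\oplus\mathsf{E}$ (totally skew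 part; kernel $\mathsf{K}$ of total antisymmetrization and trace; pure trace part), and $\mathsf{E}\otimes S^2_0\mathsf{E}\cong S^3_0\mathsf{E}\oplus\mathsf{K}\oplus\mathsf{E}$. In $\Lambda^2[\mathsf{EH}]^*\otimes[\mathsf{EH}]$ the $S^3\mathsf{H}$-isotypic part for $\mathsf{Sp}(1)$ is $[(\mathsf{E}\otimes\Lambda^2\mathsf{E})S^3\mathsf{H}]^*=[\mathsf{K}S^3\mathsf{H}]^*\oplus[\Lambda^3\mathsf{E}S^3\mathsf{H}]^*\oplus[\mathsf{E}S^3\mathsf{H}]^*=:\mathcal{X}_1\oplus\mathcal{X}_2\oplus\mathcal{X}_6$. Identify $[S^2_0\mathsf{E}]^*$ with the trace-free endomorphisms $B$ commuting with all $J_a$ for which $\omega(B\cdot,\cdot)$ is skew. With $\delta(A)(X,Y)=A(X,Y)-A(Y,X)$, the images under $\delta$ of the components $[\mathsf{KH}]^*,[\mathsf{EH}]^*,[S^3_0\mathsf{EH}]^*$ of $[\mathsf{EH}]^*\otimes[S^2_0\mathsf{E}]^*$ are $\mathcal{X}_3,\mathcal{X}_4,\mathcal{X}_5$. With $\pi_\omega(T)(X,Y,Z)=\mathfrak{S}_{X,Y,Z}\,\omega(T(X,Y),Z)$ (cyclic sum), $\mathcal{X}_7\cong[\mathsf{EH}]^*$ is the intersection of $\ker\pi_\omega$ with $\mathcal{X}_4\oplus\delta([\mathsf{EH}]^*\otimes\mathrm{Id})$. Write $\mathcal{X}_{i_1\ldots i_j}=\mathcal{X}_{i_1}\oplus\cdots\oplus\mathcal{X}_{i_j}$.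 Connections: the Obata connection $\nabla^H$ is the unique connection preserving $H$ with torsion $T^H=\frac16(N_{J_1}+N_{J_2}+N_{J_3})$, where $N_J(X,Y)=[JX,JY]-[X,Y]-J[JX,Y]-J[X,JY]$ (equivalently, its torsion lies in $\mathcal{X}_{126}$). The canonical connection is $\nabla^{H,\omega}=\nabla^H+A$, with $\omega(A(X,Y),Z)=\frac12(\nabla^H_X\omega)(Y,Z)$; it preserves $H$ and $\omega$ and its torsion takes values in $\mathcal{X}_{1234567}$. $(H,\omega)$ is of type $\mathcal{X}_{i_1\ldots i_j}$ if the torsion of $\nabla^{H,\omega}$ takes values in $\mathcal{X}_{i_1\ldots i_j}$. *)

(* Defs.v *)
From mathcomp Require Import all_boot all_order all_algebra.
From mathcomp Require Import all_classical all_reals all_analysis.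
From mathcomp Require Import complex.

Set Implicit Arguments.
Unset Strict Implicit.
Unset Printing Implicit Defensive.

Import Order.TTheory GRing.Theory Num.Theory.
Import numFieldNormedType.Exports.

Local Open Scope classical_set_scope.
Local Open Scope ring_scope.


(* [f] is of class C^k on the open set [D]; its values outside [D] are
   irrelevant.  'D_v f x is the derivative of [f] at [x] along [v]. *)
Fixpoint Ck (R : realType) (V W : normedModType R) (k : nat)
    (D : set V) (f : V -> W) : Prop :=
  match k with
  | 0%N => forall x, D x -> {for x, continuous f}
  | k'.+1 => (forall x, D x -> differentiable f x) /\
             (forall v, Ck k' D (fun x => 'D_v f x))
  end.

Definition smooth_on (R : realType) (V W : normedModType R)
    (D : set V) (f : V -> W) : Prop := forall k, Ck k D f.

(* A smooth atlas modelled on R^m (column vectors).  The chart [i] is the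
   homeomorphism [to i] from [dom i] onto [cod i], with inverse [from i]. *)
Record smooth_atlas (R : realType) (M : topologicalType) (m : nat) := SmoothAtlas {
  chart : Type;
  dom : chart -> set M;
  cod : chart -> set 'cV[R]_m;
  to : chart -> M -> 'cV[R]_m;
  from : chart -> 'cV[R]_m -> M;
  dom_open : forall i, open (dom i);
  cod_open : forall i, open (cod i);
  dom_cover : forall x, exists i, dom i x;
  to_cod : forall i x, dom i x -> cod i (to i x);
  from_dom : forall i p, cod i p -> dom i (from i p);
  toK : forall i x, dom i x -> from i (to i x) = x;
  fromK : forall i p, cod i p -> to i (from i p) = p;
  to_continuous : forall i x, dom i x -> {for x, continuous (to i)};
  from_continuous : forall i p, cod i p -> {for p, continuous (from i)};
  transition_smooth : forall i j,
    smooth_on (cod i `&` from i @^-1` dom j) (fun p => to j (from i p))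
}.

Definition connected_manifold (M : topologicalType) : Prop :=
  [/\ hausdorff_space M, @second_countable M & connected [set: M]].

Section Fields.
Variables (R : realType) (M : topologicalType) (m : nat) (S : smooth_atlas R M m).
Local Notation vec := 'cV[R]_m.

Definition overlap (i j : chart S) : set vec := cod i `&` from i @^-1` dom j.
Definition transition (i j : chart S) (p : vec) : vec := to j (from i p).
Definition dtransition (i j : chart S) (p u : vec) : vec :=
  'D_u (transition i j) p.

(* The value at (u, v) of the bilinear form with Gram matrix [Om]. *)
Definition form_at (F : pzRingType) (Om : 'M[F]_m) (u v : 'cV[F]_m) : F :=
  (u^T *m Om *m v) 0 0.

(* An element A of V^* (x) End V, V = F^m, is given by the endomorphisms
   A(e_k); [contract A u] is the endomorphism A(u). *)
Definition contract (F : pzRingType) (A : 'I_m -> 'M[F]_m) (u : 'cV[F]_m) : 'M[F]_m :=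
  \sum_k u k 0 *: A k.

(* Tensor fields are given by their components in the charts of the atlas,
   with the usual transformation laws under changes of charts. *)
Record endo_field := EndoField {
  endo_comp :> chart S -> vec -> 'M[R]_m;
  endo_smooth : forall i, smooth_on (cod i) (endo_comp i);
  endo_compat : forall i j p u, overlap i j p ->
    dtransition i j p (endo_comp i p *m u) =
    endo_comp j (transition i j p) *m dtransition i j p u
}.

Record two_form := TwoForm {
  form_comp :> chart S -> vec -> 'M[R]_m;
  form_smooth : forall i, smooth_on (cod i) (form_comp i);
  form_skew : forall i p, cod i p ->
    forall u v, form_at (form_comp i p) u v = - form_at (form_comp i p) v u;
  form_compat : forall i j p u v, overlap i j p ->
    form_at (form_comp i p) u v =
    form_at (form_comp j (transition i j p)) (dtransition i j p u) (dtransition i j p v)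
}.

(* Affine connections, given by their Christoffel symbols: in the chart [i],
   nabla_X Y = D_X Y + Gamma(X) Y. *)
Record connection := Connection {
  christoffel :> chart S -> vec -> 'I_m -> 'M[R]_m;
  christoffel_smooth : forall i k, smooth_on (cod i) (fun p => christoffel i p k);
  christoffel_compat : forall i j p u v, overlap i j p ->
    dtransition i j p (contract (christoffel i p) u *m v) =
    'D_u (fun q => dtransition i j q v) p +
    contract (christoffel j (transition i j p)) (dtransition i j p u)
      *m dtransition i j p v
}.

(* Local calculus in a chart: X, Y, Z are vector fields, J an endomorphism
   field, Om a 2-form and G a Christoffel symbol on an open subset of R^m. *)
Implicit Types (X Y Z : vec -> vec) (J Om : vec -> 'M[R]_m)
  (G : vec -> 'I_m -> 'M[R]_m).

Definition bracket X Y : vec -> vec := fun p => 'D_(X p) Y p - 'D_(Y p) X p.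

Definition apply_endo J X : vec -> vec := fun p => J p *m X p.

Definition nijenhuis J X Y : vec -> vec := fun p =>
  bracket (apply_endo J X) (apply_endo J Y) p - bracket X Y p
  - J p *m bracket (apply_endo J X) Y p - J p *m bracket X (apply_endo J Y) p.

Definition pairing Om X Y : vec -> R^o := fun p => form_at (Om p) (X p) (Y p).

Definition cov G X Y : vec -> vec := fun p => 'D_(X p) Y p + contract (G p) (X p) *m Y p.

Definition torsion G X Y : vec -> vec := fun p =>
  cov G X Y p - cov G Y X p - bracket X Y p.

Definition cov_form G Om X Y Z : vec -> R := fun p =>
  'D_(X p) (pairing Om Y Z) p - pairing Om (cov G X Y) Z p - pairing Om Y (cov G X Z) p.

Definition ext_d Om X Y Z : vec -> R := fun p =>
  'D_(X p) (pairing Om Y Z) p + 'D_(Y p) (pairing Om Z X) p + 'D_(Z p) (pairing Om X Y) p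
  - pairing Om (bracket X Y) Z p - pairing Om (bracket Y Z) X p - pairing Om (bracket Z X) Y p.

Definition vector_field (i : chart S) X : Prop := smooth_on (cod i) X.

Definition integrable (J : endo_field) : Prop :=
  forall i X Y, vector_field i X -> vector_field i Y ->
  forall p, cod i p -> nijenhuis (J i) X Y p = 0.

Definition symplectic (om : two_form) : Prop :=
  forall i X Y Z, vector_field i X -> vector_field i Y -> vector_field i Z ->
  forall p, cod i p -> ext_d (om i) X Y Z p = 0.

Definition preserves (nab : connection) (J : endo_field) : Prop :=
  forall i X Y, vector_field i X -> vector_field i Y ->
  forall p, cod i p ->
    cov (nab i) X (apply_endo (J i) Y) p = J i p *m cov (nab i) X Y p.

(* The torsion of [nab], at every point, belongs to the set [P i p] of bilinear
   maps on the tangent space. *)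
Definition torsion_valued (nab : connection)
    (P : chart S -> vec -> (vec -> vec -> vec) -> Prop) : Prop :=
  forall i p, cod i p -> exists2 T, P i p T &
    forall X Y, vector_field i X -> vector_field i Y ->
      torsion (nab i) X Y p = T (X p) (Y p).

Definition almost_complex (J : endo_field) : Prop :=
  forall i p, cod i p -> J i p *m J i p = - 1%:M.

Definition almost_hypercomplex (J1 J2 J3 : endo_field) : Prop :=
  [/\ almost_complex J1, almost_complex J2, almost_complex J3 &
   forall i p, cod i p ->
     J1 i p *m J2 i p = J3 i p /\ - (J2 i p *m J1 i p) = J3 i p].

Definition hypercomplex (J1 J2 J3 : endo_field) : Prop :=
  [/\ integrable J1, integrable J2 & integrable J3].

Definition hermitian (om : two_form) (J : endo_field) : Prop :=
  forall i p, cod i p -> forall u v,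
    form_at (om i p) (J i p *m u) (J i p *m v) = form_at (om i p) u v.

Definition scalar_form (J1 J2 J3 : endo_field) (om : two_form) : Prop :=
  [/\ forall i p, cod i p -> om i p \in unitmx,
      hermitian om J1, hermitian om J2 & hermitian om J3].

Definition obata (J1 J2 J3 : endo_field) (nab : connection) : Prop :=
  [/\ preserves nab J1, preserves nab J2, preserves nab J3 &
   forall i X Y, vector_field i X -> vector_field i Y ->
   forall p, cod i p ->
     torsion (nab i) X Y p =
     6%:R^-1 *: (nijenhuis (J1 i) X Y p + nijenhuis (J2 i) X Y p
                 + nijenhuis (J3 i) X Y p)].

(* [nab] = [nabH] + A with om(A(X,Y),Z) = 1/2 (nabH_X om)(Y,Z). *)
Definition canonical_connection (om : two_form) (nabH nab : connection) : Prop :=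
  forall i X Y Z, vector_field i X -> vector_field i Y -> vector_field i Z ->
  forall p, cod i p ->
    form_at (om i p) (cov (nab i) X Y p - cov (nabH i) X Y p) (Z p) =
    2%:R^-1 * cov_form (nabH i) (om i) X Y Z p.

End Fields.


(* V = R^4n is a tangent space, with complex structures J1, J2, J3 satisfying
   the quaternionic relations and a scalar 2-form Om.
   The decomposition V (x) C = E (x) H is realized as follows.  Let (h, h') be
   the basis of H = C^2 with J1 h = i h, J2 h = h' (so J1 h' = - i h',
   J2 h' = - h).  Then E (x) h is the i-eigenspace of J1; E is identified with
   it by e |-> e (x) h, and then e (x) h' = J2 (e (x) h).  An endomorphism of V
   commuting with J1, J2, J3 acts on V (x) C as b (x) id_H, and b is its
   restriction to E. *)
Section Modules.
Variables (R : realType) (n : nat).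
Local Notation m := (4 * n)%N.
Local Notation C := R[i].
Variables (J1 J2 J3 Om : 'M[R]_m).
Local Notation vec := 'cV[R]_m.
Local Notation cvec := 'cV[C]_m.
Local Notation cplx := (map_mx (real_complex R)).
Local Notation om := (form_at Om).

Definition inE (e : cvec) : Prop := cplx J1 *m e = 'i%C *: e.

(* e (x) (a h + b h') *)
Definition EtensorH (e : cvec) (a b : C) : cvec := a *: e + b *: (cplx J2 *m e).

(* The complex symmetric form of E:  om(e (x) h, f (x) h'). *)
Definition gE (e f : cvec) : C := form_at (cplx Om) e (cplx J2 *m f).

(* [S^2_0 E]^* *)
Definition S20E (B : 'M[R]_m) : Prop :=
  [/\ \tr B = 0,
      [/\ B *m J1 = J1 *m B, B *m J2 = J2 *m B & B *m J3 = J3 *m B] &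
      forall u v, om (B *m u) v = - om (B *m v) u].

(* [EH]^* (x) [S^2_0 E]^* *)
Definition EH_S20E (A : 'I_m -> 'M[R]_m) : Prop := forall u, S20E (contract A u).

(* The element of E^* (x) S^2_0 E^* obtained by evaluating the H-slot of
   A in EH^* (x) S^2_0 E^* at a h + b h'. *)
Definition Etensor (A : 'I_m -> 'M[R]_m) (a b : C) (e f g : cvec) : C :=
  gE (contract (fun k => cplx (A k)) (EtensorH e a b) *m f) g.

(* [S^3_0 E H]^*: the totally symmetric elements; being trace-free in (f, g),
   they are then totally trace-free. *)
Definition S30EH (A : 'I_m -> 'M[R]_m) : Prop :=
  EH_S20E A /\
  forall a b e f g, inE e -> inE f -> inE g ->
    Etensor A a b e f g = Etensor A a b f e g /\
    Etensor A a b e f g = Etensor A a b e g f.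

(* [EH]^* in [EH]^* (x) [S^2_0 E]^*: the pure trace elements, determined by a
   real covector theta on V, extended complex linearly to E (x) H; the last
   coefficient makes the right-hand side gE-trace-free in (f, g), as
   dim E = 2n. *)
Definition EH_part (A : 'I_m -> 'M[R]_m) : Prop :=
  EH_S20E A /\
  exists theta : 'rV[R]_m, forall a b e f g, inE e -> inE f -> inE g ->
    let th x := (cplx theta *m EtensorH x a b) 0 0 in
    Etensor A a b e f g =
    th f * gE e g + th g * gE e f - n%:R^-1 * th e * gE f g.

Definition delta (A : 'I_m -> 'M[R]_m) (u v : vec) : vec :=
  contract A u *m v - contract A v *m u.

(* theta (x) Id *)
Definition covector_Id (theta : 'rV[R]_m) : 'I_m -> 'M[R]_m :=
  fun k => (theta 0 k)%:M.

Definition pi_omega (T : vec -> vec -> vec) (u v w : vec) : R :=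
  om (T u v) w + om (T v w) u + om (T w u) v.

Definition X4 (T : vec -> vec -> vec) : Prop :=
  exists2 A, EH_part A & forall u v, T u v = delta A u v.

Definition X5 (T : vec -> vec -> vec) : Prop :=
  exists2 A, S30EH A & forall u v, T u v = delta A u v.

Definition X7 (T : vec -> vec -> vec) : Prop :=
  (exists T4 theta, X4 T4 /\
     forall u v, T u v = T4 u v + delta (covector_Id theta) u v) /\
  (forall u v w, pi_omega T u v w = 0).

Definition X57 (T : vec -> vec -> vec) : Prop :=
  exists T5 T7, [/\ X5 T5, X7 T7 & forall u v, T u v = T5 u v + T7 u v].

End Modules.

Definition type_X57 (R : realType) (M : topologicalType) (n : nat)
    (S : smooth_atlas R M (4 * n)) (J1 J2 J3 : endo_field S) (om : two_form S)
    (nab : connection S) : Prop :=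
  torsion_valued nab (fun i p => X57 (J1 i p) (J2 i p) (J3 i p) (om i p)).

(* Main.v *)
(* Pointwise, the canonical connection differs from the Obata connection by a
   tensor A in V^* (x) [S^2 E]^*, and it preserves H and om.

   If H is hypercomplex, the torsion is delta(A), and d om = 0 says that the
   cyclic sum of om(A(X,Y),Z) vanishes.  On V (x) C = E (x) H, where om is
   gE (x) eps, the identity eps(h',h'') h + cyclic = 0 turns this into the total
   symmetry of A in its three E-slots, so A lies in [S^3 E H]^*, which is
   [S^3_0 E H]^* + [EH]^*; delta maps the trace part into X_7.

   Conversely, a torsion of the form delta(B), with B taking values in the
   commutant of H, contributes nothing to the Nijenhuis tensors, and d om is
   pi_omega of the torsion. *)

From HB Require Import structures.
From mathcomp Require Import all_boot all_order all_algebra.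
From mathcomp Require Import all_classical all_reals all_analysis.
From mathcomp Require Import complex ring.
Require Import Defs.

Section Preliminaries.
Set Implicit Arguments.
Unset Strict Implicit.
Unset Printing Implicit Defensive.
Import Order.TTheory GRing.Theory Num.Theory.
Local Open Scope ring_scope.

(** * Algebra of quaternionic skew-Hermitian forms *)

Section BilinearForms.

Variables (F : comPzRingType) (m : nat).
Implicit Types (B Om : 'M[F]_m) (u v w : 'cV[F]_m) (A : 'I_m -> 'M[F]_m).

Lemma form_atDl Om u v w : form_at Om (u + v) w = form_at Om u w + form_at Om v w.
Proof. by rewrite /form_at linearD /= !mulmxDl mxE. Qed.

Lemma form_atDr Om u v w : form_at Om u (v + w) = form_at Om u v + form_at Om u w.
Proof. by rewrite /form_at mulmxDr mxE. Qed.

Lemma form_atZl Om a u v : form_at Om (a *: u) v = a * form_at Om u v.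
Proof. by rewrite /form_at linearZ /= -!scalemxAl mxE. Qed.

Lemma form_atZr Om a u v : form_at Om u (a *: v) = a * form_at Om u v.
Proof. by rewrite /form_at -scalemxAr mxE. Qed.

Lemma form_atNl Om u v : form_at Om (- u) v = - form_at Om u v.
Proof. by rewrite -scaleN1r form_atZl mulN1r. Qed.

Lemma form_atNr Om u v : form_at Om u (- v) = - form_at Om u v.
Proof. by rewrite -scaleN1r form_atZr mulN1r. Qed.

Lemma form_atBl Om u v w : form_at Om (u - v) w = form_at Om u w - form_at Om v w.
Proof. by rewrite form_atDl form_atNl. Qed.

Lemma form_at_eqP Om Om' :
  (forall u v, form_at Om u v = form_at Om' u v) <-> Om = Om'.
Proof.
split=> [E|-> //]; apply/matrixP => i j.
have := E (delta_mx i 0) (delta_mx j 0).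
by rewrite /form_at !trmx_delta -!rowE -!colE !mxE.
Qed.

Lemma form_at_mull Om B u v : form_at Om (B *m u) v = form_at (B^T *m Om) u v.
Proof. by rewrite /form_at trmx_mul !mulmxA. Qed.

Lemma form_at_mulr Om B u v : form_at Om u (B *m v) = form_at (Om *m B) u v.
Proof. by rewrite /form_at !mulmxA. Qed.

Lemma form_at_tr Om u v : form_at Om^T u v = form_at Om v u.
Proof.
rewrite /form_at; transitivity ((v^T *m Om *m u)^T 0 0); last by rewrite mxE.
by rewrite !trmx_mul trmxK mulmxA.
Qed.

Lemma contractD A u v : contract A (u + v) = contract A u + contract A v.
Proof.
by rewrite /contract -big_split; apply: eq_bigr => k _; rewrite mxE scalerDl.
Qed.

Lemma contractZ A a u : contract A (a *: u) = a *: contract A u.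
Proof.
by rewrite /contract scaler_sumr; apply: eq_bigr => k _; rewrite mxE scalerA.
Qed.

Lemma contract_add A A' u :
  contract (fun k => A k + A' k) u = contract A u + contract A' u.
Proof.
by rewrite /contract -big_split; apply: eq_bigr => k _; rewrite scalerDr.
Qed.

Lemma contract_sub A A' u :
  contract (fun k => A k - A' k) u = contract A u - contract A' u.
Proof.
by rewrite /contract -sumrB; apply: eq_bigr => k _; rewrite scalerBr.
Qed.

Lemma contract_delta A k : contract A (delta_mx k 0) = A k.
Proof.
rewrite /contract (bigD1 k) //= big1 => [|i /negPf ik]; last first.
  by rewrite mxE ik scale0r.
by rewrite mxE !eqxx scale1r addr0.
Qed.

Lemma contract_linear (L : 'cV[F]_m -> 'M[F]_m) u : linear L ->
  contract (fun k => L (delta_mx k 0)) u = L u.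
Proof.
move=> hL.
have LD x y : L (x + y) = L x + L y by rewrite -[x]scale1r hL !scale1r.
have L0 : L 0 = 0 by apply: (addrI (L 0)); rewrite -LD !addr0.
rewrite [in RHS](matrix_sum_delta u) (big_morph L LD L0) /contract.
by apply: eq_bigr => k _; rewrite big_ord1 -[_ *: _ in RHS]addr0 hL L0 addr0.
Qed.

End BilinearForms.

Section QuaternionicForms.

(** A generating set of matrix identities: the rest of the quaternion table and invariance under
    [J3] follow. Stated over any commutative ring so as to serve on V and on V (x) C. *)
Definition quaternionic_form (F : comPzRingType) m (J1 J2 J3 Om : 'M[F]_m) : Prop :=
  [/\ J1 *m J1 = - 1%:M, J2 *m J2 = - 1%:M, J1 *m J2 = J3 & J2 *m J1 = - J3] /\
  [/\ Om^T = - Om, J1^T *m Om *m J1 = Om & J2^T *m Om *m J2 = Om].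

(* The endomorphisms [S^2 E]^* = [S^2_0 E]^* + R Id *)
Definition S2E (F : comPzRingType) m (J1 J2 J3 Om B : 'M[F]_m) : Prop :=
  [/\ B *m J1 = J1 *m B, B *m J2 = J2 *m B, B *m J3 = J3 *m B &
      forall u v, form_at Om (B *m u) v = - form_at Om (B *m v) u].

Definition cyclic_sum (F : comPzRingType) m (Om : 'M[F]_m) (A : 'I_m -> 'M[F]_m)
    (u v w : 'cV[F]_m) : F :=
  form_at Om (contract A u *m v) w + form_at Om (contract A v *m w) u
  + form_at Om (contract A w *m u) v.

Section Relations.
Variables (F : comPzRingType) (m : nat) (J1 J2 J3 Om : 'M[F]_m).
Hypothesis hJ : quaternionic_form J1 J2 J3 Om.
Local Notation om := (form_at Om).

Lemma quaternion_table :
  [/\ J1 *m J1 = - 1%:M, J2 *m J2 = - 1%:M & J3 *m J3 = - 1%:M] /\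
  [/\ J1 *m J2 = J3, J2 *m J1 = - J3, J2 *m J3 = J1, J3 *m J2 = - J1
    & J3 *m J1 = J2 /\ J1 *m J3 = - J2].
Proof.
have [[a b c d] _] := hJ.
have e : J2 *m J3 = J1.
  by rewrite -[J3]opprK -d mulmxN mulmxA b mulNmx mul1mx opprK.
have f : J3 *m J2 = - J1 by rewrite -c -mulmxA b mulmxN mulmx1.
have g : J3 *m J1 = J2.
  by rewrite -[J3]opprK -d mulNmx -mulmxA a mulmxN mulmx1 opprK.
have h : J1 *m J3 = - J2 by rewrite -c mulmxA a mulNmx mul1mx.
by split; split => //; rewrite -{1}c -mulmxA e a.
Qed.

Lemma om_skew u v : om u v = - om v u.
Proof.
have [_ [h _ _]] := hJ.
by rewrite -[in RHS]form_at_tr h /form_at mulmxN mulNmx [in RHS]mxE opprK.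
Qed.

(** Invariance under [J1] and [J1] squared being -1 make [J1] skew-adjoint; as [om] is skew, om(.,
    J1 .) is then symmetric. *)
Lemma om_move1 u v : om (J1 *m u) v = - om u (J1 *m v).
Proof.
have [[h _ _ _] [_ k _]] := hJ.
rewrite form_at_mull form_at_mulr.
suff -> : J1^T *m Om = - (Om *m J1) by rewrite /form_at mulmxN mulNmx mxE.
by rewrite -[in RHS]k -mulmxA h mulmxN mulmx1 opprK.
Qed.

Lemma om_move2 u v : om (J2 *m u) v = - om u (J2 *m v).
Proof.
have [[_ h _ _] [_ _ k]] := hJ.
rewrite form_at_mull form_at_mulr.
suff -> : J2^T *m Om = - (Om *m J2) by rewrite /form_at mulmxN mulNmx mxE.
by rewrite -[in RHS]k -mulmxA h mulmxN mulmx1 opprK.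
Qed.

Lemma om_move3 u v : om (J3 *m u) v = - om u (J3 *m v).
Proof.
have [_ [h2 h3 h4 h5 _]] := quaternion_table.
rewrite -{1}h2 -mulmxA om_move1 om_move2 mulmxA h3 mulNmx form_atNr.
by rewrite !opprK.
Qed.

Lemma om_sym1 u v : om u (J1 *m v) = om v (J1 *m u).
Proof. by rewrite om_skew om_move1 opprK. Qed.

Lemma om_sym2 u v : om u (J2 *m v) = om v (J2 *m u).
Proof. by rewrite om_skew om_move2 opprK. Qed.

Lemma om_sym3 u v : om u (J3 *m v) = om v (J3 *m u).
Proof. by rewrite om_skew om_move3 opprK. Qed.

Lemma S2E_add B B' : S2E J1 J2 J3 Om B -> S2E J1 J2 J3 Om B' ->
  S2E J1 J2 J3 Om (B + B').
Proof.
move=> [a b c d] [a' b' c' d']; split.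
- by rewrite mulmxDl mulmxDr a a'.
- by rewrite mulmxDl mulmxDr b b'.
- by rewrite mulmxDl mulmxDr c c'.
- by move=> u v; rewrite !mulmxDl !form_atDl d d' opprD.
Qed.

Lemma S2E_scale a B : S2E J1 J2 J3 Om B -> S2E J1 J2 J3 Om (a *: B).
Proof.
move=> [h1 h2 h3 h4]; split.
- by rewrite -scalemxAl -scalemxAr h1.
- by rewrite -scalemxAl -scalemxAr h2.
- by rewrite -scalemxAl -scalemxAr h3.
- by move=> u v; rewrite -!scalemxAl !form_atZl h4 mulrN.
Qed.

Lemma S2E_scalar a : S2E J1 J2 J3 Om a%:M.
Proof.
split; rewrite ?scalar_mxC // => u v.
by rewrite !mul_scalar_mx !form_atZl om_skew mulrN.
Qed.

Lemma S2E_sum (I : finType) (B : I -> 'M[F]_m) :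
  (forall i, S2E J1 J2 J3 Om (B i)) -> S2E J1 J2 J3 Om (\sum_i B i).
Proof.
move=> h; elim/big_ind : _ => // [|B1 B2]; last exact: S2E_add.
by rewrite -(scale0r 1%:M); apply/S2E_scale/S2E_scalar.
Qed.

Lemma S2E_contract A u : (forall k, S2E J1 J2 J3 Om (A k)) ->
  S2E J1 J2 J3 Om (contract A u).
Proof. by move=> h; apply: S2E_sum => k; apply: S2E_scale. Qed.

(* Four times the projection of End V onto the commutant of H. *)
Definition commutant_proj (B : 'M[F]_m) : 'M[F]_m :=
  B - J1 *m B *m J1 - J2 *m B *m J2 - J3 *m B *m J3.

(** [commutant_proj B] is the sum of q B q^-1 over q = 1, J1, J2, J3, and conjugation by any of
    these permutes the summands; the [AC] patterns record the permutation. *)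
Lemma commutant_projC B :
  [/\ commutant_proj B *m J1 = J1 *m commutant_proj B,
      commutant_proj B *m J2 = J2 *m commutant_proj B &
      commutant_proj B *m J3 = J3 *m commutant_proj B].
Proof.
have [[a b c] [d e f g [h i]]] := quaternion_table.
split; rewrite /commutant_proj !(mulmxBl, mulmxBr) !mulmxA.
- rewrite -(mulmxA (J1 *m B)) -(mulmxA (J2 *m B)) -(mulmxA (J3 *m B)).
  rewrite a e h d i !(mulNmx, mulmxN, mul1mx, mulmx1, opprK).
  by rewrite [RHS](AC (2*1*1) (2*1*4*3)).
- rewrite -(mulmxA (J1 *m B)) -(mulmxA (J2 *m B)) -(mulmxA (J3 *m B)).
  rewrite b d g e f !(mulNmx, mulmxN, mul1mx, mulmx1, opprK).
  by rewrite [RHS](AC (2*1*1) (3*4*1*2)).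
- rewrite -(mulmxA (J1 *m B)) -(mulmxA (J2 *m B)) -(mulmxA (J3 *m B)).
  rewrite c i f h g !(mulNmx, mulmxN, mul1mx, mulmx1, opprK).
  by rewrite [RHS](AC (2*1*1) (4*3*2*1)).
Qed.

Lemma commutant_proj_linear : linear commutant_proj.
Proof.
move=> a B B'; rewrite /commutant_proj !(mulmxDl, mulmxDr, =^~ scalemxAr, =^~ scalemxAl).
rewrite !scalerBr !opprD; by rewrite [LHS](AC (2*2*2*2) ((1*3*5*7)*(2*4*6*8))).
Qed.

Lemma trace_commutant_proj B : \tr (commutant_proj B) = 4%:R * \tr B.
Proof.
have [[a b c] _] := quaternion_table.
rewrite /commutant_proj !linearB /= !(mxtrace_mulC (_ *m B)) !mulmxA a b c.
by rewrite !mulNmx !mul1mx !linearN /=; ring.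
Qed.

Lemma om_commutant_proj B u v :
  om (commutant_proj B *m u) v = om (B *m u) v + om (B *m (J1 *m u)) (J1 *m v)
    + om (B *m (J2 *m u)) (J2 *m v) + om (B *m (J3 *m u)) (J3 *m v).
Proof.
rewrite /commutant_proj !mulmxBl !form_atBl -!mulmxA om_move1 om_move2 om_move3.
by rewrite !opprK.
Qed.

End Relations.
End QuaternionicForms.

(** * The trace component of V^* (x) [S^2 E]^* *)

Section TracePart.

Variables (F : numFieldType) (m : nat) (J1 J2 J3 Om : 'M[F]_m).
Hypothesis hJ : quaternionic_form J1 J2 J3 Om.
Local Notation om := (form_at Om).

(* For the covector theta = om(t, .), the element of V^* (x) [S^2 E]^* given by
   the symmetrization of theta (x) gE. *)
Definition trace_part (t u : 'cV[F]_m) : 'M[F]_m :=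
  (om t u)%:M + 2%:R^-1 *:
    commutant_proj J1 J2 J3 (u *m (t^T *m Om) - t *m (u^T *m Om)).

Lemma trace_part_linear t : linear (trace_part t).
Proof.
pose B w := w *m (t^T *m Om) - t *m (w^T *m Om).
have hB a u v : B (a *: u + v) = a *: B u + B v.
  rewrite /B linearD linearZ /= !mulmxDl !mulmxDr -!scalemxAl -!scalemxAr.
  by rewrite scalerBr opprD addrACA.
pose Q w := 2%:R^-1 *: commutant_proj J1 J2 J3 (B w).
have QE w : trace_part t w = (om t w)%:M + Q w by [].
have hQ a u v : Q (a *: u + v) = a *: Q u + Q v.
  by rewrite /Q hB commutant_proj_linear scalerDr !scalerA (mulrC a).
move=> a u v; rewrite !QE hQ form_atDr form_atZr (raddfD (@scalar_mx F m)) /=.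
rewrite -scale_scalar_mx; move: (Q u) (Q v) => x y.
by rewrite scalerDr addrACA.
Qed.

Lemma om_rank1 t u v w :
  om ((u *m (t^T *m Om) - t *m (u^T *m Om)) *m v) w =
  om t v * om u w - om u v * om t w.
Proof.
have E (x y : 'cV[F]_m) : x *m (y^T *m Om) *m v = om y v *: x.
  by rewrite -mulmxA [y^T *m Om *m v]mx11_scalar mul_mx_scalar.
by rewrite mulmxBl !E form_atBl !form_atZl.
Qed.

Lemma om_trace_part t u v w :
  om (trace_part t u *m v) w = om t u * om v w + 2%:R^-1 *
    ((om t v * om u w - om u v * om t w)
     + (om t (J1 *m v) * om u (J1 *m w) - om u (J1 *m v) * om t (J1 *m w))
     + (om t (J2 *m v) * om u (J2 *m w) - om u (J2 *m v) * om t (J2 *m w))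
     + (om t (J3 *m v) * om u (J3 *m w) - om u (J3 *m v) * om t (J3 *m w))).
Proof.
rewrite mulmxDl form_atDl mul_scalar_mx form_atZl -scalemxAl form_atZl.
by rewrite (om_commutant_proj hJ) !om_rank1.
Qed.

Lemma trace_part_S2E t u : S2E J1 J2 J3 Om (trace_part t u).
Proof.
have [c1 c2 c3] := commutant_projC hJ (u *m (t^T *m Om) - t *m (u^T *m Om)).
split.
- by rewrite mulmxDl mulmxDr scalar_mxC -scalemxAl -scalemxAr c1.
- by rewrite mulmxDl mulmxDr scalar_mxC -scalemxAl -scalemxAr c2.
- by rewrite mulmxDl mulmxDr scalar_mxC -scalemxAl -scalemxAr c3.
by move=> v w; rewrite !om_trace_part (om_skew hJ w v); ring.
Qed.

(** The scalar term contributes m. The rank-two matrix has trace 2 om(t,u), which [commutant_proj]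
    multiplies by 4 and the coefficient halves: this gives the 4. *)
Lemma tr_trace_part t u : \tr (trace_part t u) = (m + 4)%:R * om t u.
Proof.
have E (x y : 'cV[F]_m) : \tr (x *m (y^T *m Om)) = om y x.
  by rewrite mxtrace_mulC trace_mx11.
rewrite linearD linearZ /= mxtrace_scalar (trace_commutant_proj hJ) linearB /=.
rewrite !E (om_skew hJ u t) -[_ *+ m]mulr_natl natrD.
by field.
Qed.

(** For each a the terms in J_a cancel cyclically because om(., J_a .) is symmetric. What remains is
    the cyclic sum of om(t,u) om(v,w) with coefficient 1 - 2/2 = 0; this is what fixes the factor
    1/2 in [trace_part]. *)
Lemma trace_part_cyclic t u v w :
  om (trace_part t u *m v) w + om (trace_part t v *m w) u
  + om (trace_part t w *m u) v = 0.
Proof.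
rewrite !om_trace_part (om_sym1 hJ w u) (om_sym1 hJ w v) (om_sym1 hJ v u).
rewrite (om_sym2 hJ w u) (om_sym2 hJ w v) (om_sym2 hJ v u).
rewrite (om_sym3 hJ w u) (om_sym3 hJ w v) (om_sym3 hJ v u).
rewrite (om_skew hJ w u) (om_skew hJ w v) (om_skew hJ v u).
by field.
Qed.

End TracePart.

(** * The eigenspace E and total symmetry in the E-slots *)

Section EigenspaceE.

Variables (F : numFieldType) (m : nat) (J1 J2 J3 Om : 'M[F]_m) (ii : F).
Hypothesis hJ : quaternionic_form J1 J2 J3 Om.
Hypothesis hi : ii ^+ 2 = -1.
Local Notation om := (form_at Om).
Local Notation E := (fun e : 'cV[F]_m => J1 *m e = ii *: e).
Implicit Types e f g u v w : 'cV[F]_m.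

(** Invariance under [J1] multiplies the value by [ii ^+ 2], that is, by -1. *)
Lemma om_E0 e f : E e -> E f -> om e f = 0.
Proof.
move=> he hf.
have : om (J1 *m e) (J1 *m f) = om e f.
  have [[h _ _] _] := quaternion_table hJ.
  by rewrite (om_move1 hJ) mulmxA h mulNmx mul1mx form_atNr opprK.
rewrite he hf form_atZl form_atZr mulrA -expr2 hi mulN1r => h.
by apply/eqP; rewrite -[_ == 0](mulrn_eq0 _ 2) mulr2n -{1}h addNr.
Qed.

Lemma om_J2J2 u v : om (J2 *m u) (J2 *m v) = om u v.
Proof.
have [[_ h _] _] := quaternion_table hJ.
by rewrite (om_move2 hJ) mulmxA h mulNmx mul1mx form_atNr opprK.
Qed.

Lemma S2E_E B e : S2E J1 J2 J3 Om B -> E e -> E (B *m e).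
Proof. by case=> h _ _ _ he; rewrite mulmxA -h -mulmxA he scalemxAr. Qed.

(** [J2] commutes with B and is skew-adjoint, so it turns the skew form om(B., .) into a symmetric
    one: the last two E-slots of a tensor with values in [S2E] are always symmetric. *)
Lemma S2E_gE_sym B f g : S2E J1 J2 J3 Om B ->
  om (B *m f) (J2 *m g) = om (B *m g) (J2 *m f).
Proof.
by case=> _ h _ k; rewrite k mulmxA h -mulmxA (om_move2 hJ) opprK.
Qed.

(** The projections x and y of v to the eigenspaces ii and -ii of [J1]; [J2] anticommutes with [J1],
    hence exchanges the eigenspaces, and y = J2 (- J2 y). *)
Lemma E_decomposition v : exists e f, [/\ E e, E f & v = e + J2 *m f].
Proof.
have i0 : ii != 0.
  by apply/eqP => h; move/eqP: hi; rewrite h expr0n /= eq_sym oppr_eq0 oner_eq0.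
have [[h1 h2 _] [_ h21 _ _ _]] := quaternion_table hJ.
have [_ [h12 _ _ _ _]] := quaternion_table hJ.
pose x := 2%:R^-1 *: (v - ii *: (J1 *m v)).
pose y := 2%:R^-1 *: (v + ii *: (J1 *m v)).
exists x, (- (J2 *m y)); split.
- rewrite /x -scalemxAr mulmxBr -scalemxAr mulmxA h1 mulNmx mul1mx.
  rewrite scalerA mulrC -scalerA; congr (_ *: _).
  by rewrite scalerBr scalerA -expr2 hi scaleN1r scalerN !opprK addrC.
- rewrite mulmxN mulmxA h12 -[J3]opprK -h21 mulNmx opprK -mulmxA.
  rewrite scalerN scalemxAr -mulmxN; congr (_ *m _).
  rewrite /y -scalemxAr scalerA mulrC -scalerA -scalerN; congr (_ *: _).
  rewrite mulmxDr -scalemxAr mulmxA h1 mulNmx mul1mx scalerDr scalerA -expr2 hi.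
  by rewrite scaleN1r opprD opprK scalerN addrC.
- rewrite mulmxN mulmxA h2 mulNmx mul1mx opprK /x /y -scalerDr addrACA addNr.
  by rewrite addr0 -mulr2n -scaler_nat scalerA mulVf ?scale1r ?pnatr_eq0.
Qed.

Variable A : 'I_m -> 'M[F]_m.
Hypothesis hA : forall k, S2E J1 J2 J3 Om (A k).
Let hAu u : S2E J1 J2 J3 Om (contract A u) := S2E_contract hJ u hA.

(* E (x) h and E (x) h' are om-isotropic, so for suitable arguments one of the
   three cyclic terms drops out and the other two exchange slots of A. *)
Lemma cyclic_sum_symmetric e f g a b :
  (forall u v w, cyclic_sum Om A u v w = 0) -> E e -> E f -> E g ->
  om (contract A (a *: e + b *: (J2 *m e)) *m f) (J2 *m g) =
  om (contract A (a *: f + b *: (J2 *m f)) *m e) (J2 *m g).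
Proof.
move=> h0 he hf hg.
have S u x y : om (contract A u *m x) (J2 *m y) = om (contract A u *m y) (J2 *m x).
  exact: S2E_gE_sym.
(* Slots of type h, h, h': the third cyclic term pairs two vectors of E and vanishes. *)
have h1 x y z : E x -> E y -> E z ->
    om (contract A x *m y) (J2 *m z) = om (contract A y *m x) (J2 *m z).
  move=> hx hy hz; have := h0 x y (J2 *m z); rewrite /cyclic_sum.
  rewrite (om_E0 (S2E_E (hAu _) hx) hy) addr0.
  have [_ _ _ ->] := hAu y.
  by move=> /eqP; rewrite subr_eq0 => /eqP.
(* Slots of type h', h, h': the second term vanishes, and the result rotates the three E-slots.
   Together with [S] this generates every permutation of them. *)
have h2 x y z : E x -> E y -> E z ->
    om (contract A (J2 *m x) *m y) (J2 *m z) = om (contract A (J2 *m z) *m x) (J2 *m y).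
  move=> hx hy hz; have := h0 (J2 *m x) y (J2 *m z); rewrite /cyclic_sum.
  have [_ c _ _] := hAu y; rewrite mulmxA c -mulmxA om_J2J2.
  rewrite (om_E0 (S2E_E (hAu _) hz) hx) addr0.
  have [_ c' _ _] := hAu (J2 *m z); rewrite mulmxA c' -mulmxA (om_move2 hJ).
  by move=> /eqP; rewrite subr_eq0 => /eqP.
rewrite !contractD !contractZ !mulmxDl !form_atDl -!scalemxAl !form_atZl (h1 e) //.
by congr (_ + _ * _); rewrite h2 // S -h2 // S.
Qed.

(** Splitting u, v, w along E and J2 E leaves twelve terms, two for each mixed choice of components;
    total symmetry makes the two cancel. *)
Lemma symmetric_cyclic_sum u v w :
  (forall a b e f g, E e -> E f -> E g ->
    om (contract A (a *: e + b *: (J2 *m e)) *m f) (J2 *m g) =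
    om (contract A (a *: f + b *: (J2 *m f)) *m e) (J2 *m g)) ->
  cyclic_sum Om A u v w = 0.
Proof.
move=> h.
have S x y z : om (contract A x *m y) (J2 *m z) = om (contract A x *m z) (J2 *m y).
  exact: S2E_gE_sym.
have h1 e f g : E e -> E f -> E g ->
    om (contract A e *m f) (J2 *m g) = om (contract A f *m e) (J2 *m g).
  by move=> he hf hg; have := h 1 0 e f g he hf hg; rewrite !scale1r !scale0r !addr0.
have h2 e f g : E e -> E f -> E g ->
    om (contract A (J2 *m e) *m f) (J2 *m g) = om (contract A (J2 *m f) *m e) (J2 *m g).
  by move=> he hf hg; have := h 0 1 e f g he hf hg; rewrite !scale1r !scale0r !add0r.
(* Both summands of the decomposition are isotropic, so only the mixed pairings survive. *)
have D x f f' g g' : E f -> E f' -> E g -> E g' ->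
    om (contract A x *m (f + J2 *m f')) (g + J2 *m g') =
    om (contract A x *m f) (J2 *m g') - om (contract A x *m f') (J2 *m g).
  move=> hf hf' hg hg'.
  have [_ c _ _] := hAu x; rewrite mulmxDr mulmxA c -mulmxA !form_atDl !form_atDr.
  rewrite (om_E0 (S2E_E (hAu _) hf)) // om_J2J2 (om_E0 (S2E_E (hAu _) hf')) //.
  by rewrite (om_move2 hJ) add0r addr0.
have [u1 [u2 [hu1 hu2 ->]]] := E_decomposition u.
have [v1 [v2 [hv1 hv2 ->]]] := E_decomposition v.
have [w1 [w2 [hw1 hw2 ->]]] := E_decomposition w.
rewrite /cyclic_sum !D // !contractD !mulmxDl !form_atDl.
rewrite (h1 u1 v1) // (S v1 u1) (S (J2 *m u2) v1) (h2 u2 w2) //.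
rewrite (S u1 v2) (h1 u1 w1) // (h2 u2 v2) // (S (J2 *m v2) u2).
rewrite (h1 v1 w1) // (S w1 v1) (h2 v2 w2) // (S (J2 *m w2) v2).
ring.
Qed.

(** On E, [J1] acts as ii and [J3] as - ii [J2]. In [om_trace_part] the [J1] term then equals the
    first one and the [J3] term equals the [J2] one, which absorbs the factor 1/2 and leaves the
    symmetrization of theta (x) gE. *)
Lemma trace_part_Etensor t a b e f g : E e -> E f -> E g ->
  let th x := om t (a *: x + b *: (J2 *m x)) in
  om (trace_part J1 J2 J3 Om t (a *: e + b *: (J2 *m e)) *m f) (J2 *m g) =
  th e * om f (J2 *m g) + th f * om e (J2 *m g) + th g * om e (J2 *m f).
Proof.
move=> he hf hg th; rewrite (om_trace_part hJ) -/(th e).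
have [[h1 h2 h3] [h4 h5 h6 h7 [h8 h9]]] := quaternion_table hJ.
have J3E x : E x -> J3 *m x = - (ii *: (J2 *m x)).
  by move=> hx; rewrite -[J3]opprK -h5 mulNmx -mulmxA hx scalemxAr.
have J12 x : E x -> J1 *m (J2 *m x) = - (ii *: (J2 *m x)).
  by move=> hx; rewrite mulmxA h4 J3E.
have J22 x : J2 *m (J2 *m x) = - x by rewrite mulmxA h2 mulNmx mul1mx.
have J32 x : E x -> J3 *m (J2 *m x) = - (ii *: x).
  by move=> hx; rewrite mulmxA h7 mulNmx hx.
have U x : E x -> om (a *: e + b *: (J2 *m e)) x = - b * om e (J2 *m x).
  by move=> hx; rewrite form_atDl !form_atZl (om_E0 he hx) (om_move2 hJ); ring.
have UJ x : E x -> om (a *: e + b *: (J2 *m e)) (J2 *m x) = a * om e (J2 *m x).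
  by move=> hx; rewrite form_atDl !form_atZl om_J2J2 (om_E0 he hx); ring.
rewrite hf (J12 g) // !J22 (J3E f) // (J32 g) //.
rewrite !(form_atNr, form_atZr) (U f) // (U g) // (UJ f) // (UJ g) // /th !form_atDr !form_atZr.
by field: hi.
Qed.

(** The scalar shift by -(1 + c) turns the coefficient 1 of th(e) gE(f,g) into -c; the case c = 1/n
    is the shape required by [EH_part]. *)
Lemma trace_free_Etensor t (theta : 'rV[F]_m) c a b e f g :
  theta = t^T *m Om -> E e -> E f -> E g ->
  let th x := (theta *m (a *: x + b *: (J2 *m x))) 0 0 in
  let U := a *: e + b *: (J2 *m e) in
  om ((trace_part J1 J2 J3 Om t U + (- (1 + c) * om t U)%:M) *m f) (J2 *m g) =
  th f * om e (J2 *m g) + th g * om e (J2 *m f) - c * th e * om f (J2 *m g).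
Proof.
move=> -> he hf hg th U; rewrite mulmxDl mul_scalar_mx form_atDl form_atZl /U.
by rewrite (trace_part_Etensor t a b he hf hg) /th /form_at; ring.
Qed.

End EigenspaceE.

(** * Complexification and the modules X_5 and X_7 *)

Section CyclicSum.

Variables (F : comPzRingType) (m : nat) (Om : 'M[F]_m) (A : 'I_m -> 'M[F]_m).

Lemma cyclic_sum_rot u v w : cyclic_sum Om A u v w = cyclic_sum Om A v w u.
Proof. by rewrite /cyclic_sum; ring. Qed.

Lemma cyclic_sum_linear a u u' v w :
  cyclic_sum Om A (u + a *: u') v w = cyclic_sum Om A u v w + a * cyclic_sum Om A u' v w.
Proof.
rewrite /cyclic_sum contractD contractZ !mulmxDl !mulmxDr -!scalemxAl -!scalemxAr.
by rewrite !form_atDl !form_atDr !form_atZl !form_atZr; ring.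
Qed.

End CyclicSum.

(** * Passage between V and V (x) C *)

Section Complexification.

Variables (R : realType) (m : nat).
Local Notation C := R[i].
Local Notation cplx := (map_mx (real_complex R)).
Implicit Types (J B Om : 'M[R]_m) (A : 'I_m -> 'M[R]_m).

Lemma cplx_decomposition (u : 'cV[C]_m) :
  exists a b : 'cV[R]_m, u = cplx a + 'i%C *: cplx b.
Proof.
exists (map_mx (@complex.Re R) u), (map_mx (@complex.Im R) u).
by apply/matrixP => i j; rewrite !mxE -complexE.
Qed.

Lemma form_at_cplx Om (u v : 'cV[R]_m) :
  form_at (cplx Om) (cplx u) (cplx v) = real_complex R (form_at Om u v).
Proof. by rewrite /form_at map_trmx -!map_mxM mxE. Qed.

Lemma contract_cplx A u :
  contract (fun k => cplx (A k)) (cplx u) = cplx (contract A u).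
Proof.
by rewrite /contract map_mx_sum; apply: eq_bigr => k _; rewrite mxE map_mxZ.
Qed.

Lemma cyclic_sum_cplx Om A u v w :
  cyclic_sum (cplx Om) (fun k => cplx (A k)) (cplx u) (cplx v) (cplx w) =
  real_complex R (cyclic_sum Om A u v w).
Proof.
by rewrite /cyclic_sum !contract_cplx -!map_mxM !form_at_cplx !rmorphD.
Qed.

(** The complexified sum is trilinear, so it vanishes once it does on real vectors: [ext] splits the
    first argument into real and imaginary parts, and rotation brings each argument there in
    turn. *)
Lemma cyclic_sum_cplx_eq0 Om A :
  (forall u v w, cyclic_sum Om A u v w = 0) <->
  (forall u v w, cyclic_sum (cplx Om) (fun k => cplx (A k)) u v w = 0).
Proof.
split=> [h u v w|h u v w]; last first.
  by apply: complexI; rewrite -cyclic_sum_cplx h rmorph0.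
have ext v' w' : (forall a, cyclic_sum (cplx Om) (fun k => cplx (A k)) (cplx a) v' w' = 0) ->
    forall x, cyclic_sum (cplx Om) (fun k => cplx (A k)) x v' w' = 0.
  move=> ha x; have [a [b ->]] := cplx_decomposition x.
  by rewrite cyclic_sum_linear !ha mulr0 addr0.
apply: (ext _ _) => a; rewrite cyclic_sum_rot; apply: (ext _ _) => b.
rewrite cyclic_sum_rot; apply: (ext _ _) => c.
by rewrite cyclic_sum_cplx h rmorph0.
Qed.

(** A complex linear map is determined by its values on real vectors, so a formula for [contract A]
    on V extends to E (x) H. *)
Lemma contract_cplx_linear A (L : 'cV[C]_m -> 'M[C]_m) U : linear L ->
  (forall u, cplx (contract A u) = L (cplx u)) ->
  contract (fun k => cplx (A k)) U = L U.
Proof.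
move=> hL hA; rewrite -(contract_linear U hL); apply: eq_bigr => k _.
by rewrite -(map_delta_mx (real_complex R)) -hA contract_delta.
Qed.

Lemma form_atN Om u v : form_at (- Om) u v = - form_at Om u v.
Proof. by rewrite /form_at mulmxN mulNmx mxE. Qed.

Lemma quaternionic_form_cplx J1 J2 J3 Om : quaternionic_form J1 J2 J3 Om ->
  quaternionic_form (cplx J1) (cplx J2) (cplx J3) (cplx Om).
Proof.
move=> [[a b c d] [e f g]]; split; split; rewrite ?map_trmx -?map_mxM.
- by rewrite a map_mxN map_mx1.
- by rewrite b map_mxN map_mx1.
- by rewrite c.
- by rewrite d map_mxN.
- by rewrite e map_mxN.
- by rewrite f.
- by rewrite g.
Qed.

Lemma S2E_cplx J1 J2 J3 Om B : S2E J1 J2 J3 Om B ->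
  S2E (cplx J1) (cplx J2) (cplx J3) (cplx Om) (cplx B).
Proof.
case=> a b c d; split; rewrite -?map_mxM ?a ?b ?c //.
(* Skewness is known on real vectors only; as a matrix identity it survives the extension of
   scalars. *)
have k : B^T *m Om = - (B^T *m Om)^T.
  by apply/form_at_eqP => u v; rewrite form_atN form_at_tr -!form_at_mull.
move=> u v; rewrite !form_at_mull -(form_at_tr _ u v).
by rewrite map_trmx -map_mxM {1}k map_mxN -map_trmx /form_at mulmxN mulNmx mxE.
Qed.

Lemma trace_part_cplx J1 J2 J3 Om t u :
  trace_part (cplx J1) (cplx J2) (cplx J3) (cplx Om) (cplx t) (cplx u) =
  cplx (trace_part J1 J2 J3 Om t u).
Proof.
rewrite /trace_part /commutant_proj form_at_cplx.
rewrite !(map_mxD, map_mxN, map_mxM, map_mxZ, map_scalar_mx, map_trmx) /=.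
by rewrite fmorphV rmorph_nat.
Qed.

End Complexification.

(** * Cyclic sums and membership in X_5 + X_7 *)

Section TypeX57.

Variables (R : realType) (n : nat) (J1 J2 J3 Om : 'M[R]_(4 * n)).
Hypothesis hJ : quaternionic_form J1 J2 J3 Om.
Local Notation cplx := (map_mx (real_complex R)).
Local Notation om := (form_at Om).
Implicit Types (A : 'I_(4 * n) -> 'M[R]_(4 * n)) (u v w : 'cV[R]_(4 * n)).

Lemma S20EP B : S20E J1 J2 J3 Om B <-> \tr B = 0 /\ S2E J1 J2 J3 Om B.
Proof. by split; [case=> a [b c d] e|case=> a [b c d e]]. Qed.

Lemma EH_S20E_S2E A k : EH_S20E J1 J2 J3 Om A -> S2E J1 J2 J3 Om (A k).
Proof. by move=> /(_ (delta_mx k 0)) /S20EP []; rewrite contract_delta. Qed.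

Lemma delta_add A A' u v : delta (fun k => A k + A' k) u v = delta A u v + delta A' u v.
Proof. by rewrite /delta !contract_add !mulmxDl opprD addrACA. Qed.

(** Skewness of om(A(x)., .) identifies the six terms in pairs, hence the factor 2. *)
Lemma pi_omega_delta A u v w : (forall k, S2E J1 J2 J3 Om (A k)) ->
  pi_omega Om (delta A) u v w = 2%:R * cyclic_sum Om A u v w.
Proof.
move=> hA; rewrite /pi_omega /delta /cyclic_sum !form_atBl.
have S x y z : om (contract A x *m y) z = - om (contract A x *m z) y.
  by have [_ _ _ ->] := S2E_contract hJ x hA.
by rewrite (S v u w) (S w v u) (S u w v); ring.
Qed.

Lemma S30EH_cyclic_sum A u v w : S30EH J1 J2 J3 Om A -> cyclic_sum Om A u v w = 0.
Proof.
move=> [hA hs]; move: u v w; apply/cyclic_sum_cplx_eq0 => u v w.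
apply: (symmetric_cyclic_sum (quaternionic_form_cplx hJ) (sqr_i R)) => [k|a b e f g he hf hg].
  by apply/S2E_cplx/EH_S20E_S2E.
exact (proj1 (hs a b e f g he hf hg)).
Qed.

Lemma cyclic_sum_S30EH A : EH_S20E J1 J2 J3 Om A ->
  (forall u v w, cyclic_sum Om A u v w = 0) -> S30EH J1 J2 J3 Om A.
Proof.
move=> hA /cyclic_sum_cplx_eq0 hc; split; [exact: hA|move=> a b e f g he hf hg].
have hAc k : S2E (cplx J1) (cplx J2) (cplx J3) (cplx Om) (cplx (A k)).
  exact/S2E_cplx/EH_S20E_S2E.
have hJc := quaternionic_form_cplx hJ.
split; first exact: (cyclic_sum_symmetric hJc (sqr_i R)).
exact/(S2E_gE_sym hJc)/(S2E_contract hJc).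
Qed.

Definition trace_part_tensor (t : 'cV[R]_(4 * n)) (k : 'I_(4 * n)) : 'M[R]_(4 * n) :=
  trace_part J1 J2 J3 Om t (delta_mx k 0).

Lemma contract_trace_part t u :
  contract (trace_part_tensor t) u = trace_part J1 J2 J3 Om t u.
Proof. exact/(contract_linear (L := trace_part J1 J2 J3 Om t))/trace_part_linear. Qed.

Lemma contract_covector_Id (theta : 'rV[R]_(4 * n)) u :
  contract (covector_Id theta) u = ((theta *m u) 0 0)%:M.
Proof.
rewrite /contract /covector_Id mxE raddf_sum /=.
by apply: eq_bigr => k _; rewrite scale_scalar_mx mulrC.
Qed.

(** [trace_part] has trace (4n + 4) om(t,u) = 4n (1 + 1/n) om(t,u), so subtracting (1 + 1/n) theta
    (x) Id makes it trace-free. *)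
Lemma trace_part_EH_part (t : 'cV[R]_(4 * n)) : (0 < n)%N ->
  EH_part J1 J2 J3 Om (fun k => trace_part_tensor t k
     + covector_Id (- (1 + n%:R^-1) *: (t^T *m Om)) k).
Proof.
move=> n0; have nR : n%:R != 0 :> R by rewrite pnatr_eq0 -lt0n.
split=> [u|].
  rewrite /EH_S20E contract_add contract_trace_part contract_covector_Id.
  apply/S20EP; split; last by apply: (S2E_add (trace_part_S2E hJ _ _)); apply: S2E_scalar hJ _.
  rewrite linearD /= (tr_trace_part hJ) mxtrace_scalar -scalemxAl mxE.
  rewrite -[_ *+ _]mulr_natl -/(om t u) natrD natrM; by field.
exists (t^T *m Om) => a b e f g he hf hg th.
(* The complex linear extension of the contraction, to which [contract_cplx_linear] applies. *)
pose L U := trace_part (cplx J1) (cplx J2) (cplx J3) (cplx Om) (cplx t) U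
  + (- (1 + n%:R^-1) * form_at (cplx Om) (cplx t) U)%:M.
have hL : linear L.
  move=> x u v; rewrite /L (trace_part_linear (cplx J1)) form_atDr form_atZr.
  rewrite mulrDr mulrCA (raddfD (@scalar_mx _ _)) /= -(scale_scalar_mx _ x).
  move: (trace_part _ _ _ _ _ u) (trace_part _ _ _ _ _ v) => y z.
  by rewrite scalerDr addrACA.
rewrite /Etensor (contract_cplx_linear _ hL) => [|u]; last first.
  rewrite contract_add contract_trace_part contract_covector_Id map_mxD.
  rewrite -trace_part_cplx map_scalar_mx -scalemxAl mxE -/(om t u) /L form_at_cplx.
  by rewrite rmorphM rmorphN rmorphD rmorph1 fmorphV rmorph_nat.
have ht : cplx (t^T *m Om) = (cplx t)^T *m cplx Om by rewrite map_mxM -map_trmx.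
exact (trace_free_Etensor (quaternionic_form_cplx hJ) (sqr_i R) _ a b ht he hf hg).
Qed.

(** A = A5 + P, where P is the trace part with the same traces as A. Both cyclic sums vanish, so the
    trace-free [A5] is totally symmetric and delta(P) is in the kernel of [pi_omega]. *)
Lemma cyclic_sum_X57 A : (0 < n)%N -> Om \in unitmx ->
  (forall k, S2E J1 J2 J3 Om (A k)) ->
  (forall u v w, cyclic_sum Om A u v w = 0) ->
  X57 J1 J2 J3 Om (delta A).
Proof.
move=> n0 uOm hA hc.
(* Normalized by the constant of [tr_trace_part] for m = 4n; invertibility of [Om] yields t with
   om(t, .) = tau. *)
pose tau : 'rV[R]_(4 * n) := \row_k ((4 * n + 4)%:R^-1 * \tr (A k)).
pose t := (tau *m invmx Om)^T.
have ht : t^T *m Om = tau by rewrite trmxK mulmxKV.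
have tauE u : om t u = (4 * n + 4)%:R^-1 * \tr (contract A u).
  rewrite /form_at ht mxE /contract raddf_sum mulr_sumr /=.
  by apply: eq_bigr => k _; rewrite mxE mxtraceZ; ring.
pose P := trace_part_tensor t.
have PE u : contract P u = trace_part J1 J2 J3 Om t u by exact: contract_trace_part.
have cP u v w : cyclic_sum Om P u v w = 0.
  by rewrite /cyclic_sum !PE trace_part_cyclic.
pose A5 k := A k - P k.
have A5E u : contract A5 u = contract A u - contract P u by exact: contract_sub.
exists (delta A5), (delta P); split.
- exists A5; last by [].
  apply: cyclic_sum_S30EH => [u|u v w].
    apply/S20EP; split.
      rewrite A5E linearB /= PE (tr_trace_part hJ) tauE mulrA mulfV ?mul1r ?subrr //.
    rewrite A5E PE -scaleN1r; apply: (S2E_add (S2E_contract hJ u hA)).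
    exact/S2E_scale/trace_part_S2E.
  have : cyclic_sum Om A u v w - cyclic_sum Om P u v w = 0 by rewrite hc cP subrr.
  move=> <-; rewrite /cyclic_sum !A5E !mulmxBl !form_atBl; ring.
- split=> [|u v w]; last first.
    by rewrite pi_omega_delta ?cP ?mulr0 // => k; exact: trace_part_S2E.
  (* P is the pure trace element of [trace_part_EH_part] plus this multiple of the identity, as [X7]
     demands. *)
  pose theta : 'rV[R]_(4 * n) := (1 + n%:R^-1) *: tau.
  exists (delta (fun k => P k + covector_Id (- theta) k)), theta; split.
    exists (fun k => P k + covector_Id (- theta) k); last by [].
    by have := trace_part_EH_part t n0; rewrite ht scaleNr.
  move=> u v; rewrite delta_add -addrA -[LHS]addr0; congr (_ + _).
  rewrite /delta !contract_covector_Id !mul_scalar_mx !mulNmx !mxE !scaleNr.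
  by rewrite opprK addrACA addNr addrN addr0.
- have AE w : contract A w = contract A5 w + contract P w by rewrite A5E subrK.
  by move=> u v; rewrite /delta !AE !mulmxDl opprD addrACA.
Qed.

(** [pi_omega] vanishes on X_5 by total symmetry and on X_7 by definition. All three tensors, theta
    (x) Id included, take values in [S2E], so they add up to a single B. *)
Lemma X57_delta T : X57 J1 J2 J3 Om T ->
  (forall u v w, pi_omega Om T u v w = 0) /\
  exists2 B, (forall k, S2E J1 J2 J3 Om (B k)) & forall u v, T u v = delta B u v.
Proof.
case=> T5 [T7 [[A5 hA5 T5E] [[T4 [theta [[A4 [hA4 _] T4E] T7E]]] pi7] TE]].
have S5 k : S2E J1 J2 J3 Om (A5 k) by apply: EH_S20E_S2E; case: hA5.
split=> [u v w|].
  have : pi_omega Om (delta A5) u v w + pi_omega Om T7 u v w = 0.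
    by rewrite pi7 pi_omega_delta // S30EH_cyclic_sum // mulr0 addr0.
  by move=> <-; rewrite /pi_omega !TE !T5E !form_atDl; ring.
exists (fun k => A5 k + (A4 k + covector_Id theta k)) => [k|u v].
  apply: (S2E_add (S5 k)); apply: S2E_add; first exact: EH_S20E_S2E.
  exact: S2E_scalar hJ _.
by rewrite TE T5E T7E T4E !delta_add.
Qed.

End TypeX57.

(** * Smooth maps and local calculus *)

Section SmoothMaps.
Import numFieldNormedType.Exports.
Local Open Scope classical_set_scope.

Variables (R : realType) (V W : normedModType R).

Lemma near_eq_differentiable (f g : V -> W) x :
  (\forall y \near x, f y = g y) -> differentiable f x -> differentiable g x.
Proof.
move=> fg df; have fgx : f x = g x by exact: nbhs_singleton fg.
(* The differential of f approximates g to first order at x, so by uniqueness it is the differential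
   of g. *)
have e : g \o shift x = cst (g x) + 'd f x +o_ 0 id.
  apply/eqaddoP => eps eps0; have /eqaddoP/(_ eps eps0) := diff_locally df.
  have fg0 : \forall y \near (0 : V), f (y + x) = g (y + x).
    by move: fg; rewrite (near_shift 0) subr0.
  apply: filterS2 fg0 => y /= E; rewrite -fgx.
  by rewrite !fctE /= E.
have dg := diff_unique (diff_continuous df) e.
by apply/diff_locallyP; rewrite dg; split=> //; exact: diff_continuous.
Qed.

Lemma smooth_on_cst (D : set V) (c : W) : smooth_on D (fun=> c).
Proof.
move=> k; elim: k c => [|k IH] c /=; first by move=> x _; exact: cst_continuous.
split=> [x _|v]; first exact: differentiable_cst.
rewrite (_ : 'D_v _ = fun=> 0); first exact: IH.
by apply/funext => x; exact: derive_cst.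
Qed.

Variables (a b : nat) (L : {linear 'M[R]_(a, b) -> W}).

Lemma linear_mx_continuous : continuous L.
Proof.
rewrite (_ : (L : _ -> _) = fun A => \sum_i \sum_j A i j *: L (delta_mx i j)).
  apply: (continuous_big (@add_continuous W)) => i _.
  apply: (continuous_big (@add_continuous W)) => j _ x.
  exact: (cvgZr_tmp (@coord_continuous R a b i j x)).
apply/funext => A; rewrite {1}(matrix_sum_delta A) linear_sum.
by apply: eq_bigr => i _; rewrite linear_sum; apply: eq_bigr => j _; rewrite linearZ.
Qed.

Lemma derive_linear_mx (f : V -> 'M[R]_(a, b)) x v : differentiable f x ->
  'D_v (L \o f) x = L ('D_v f x).
Proof.
move=> df; have cL := linear_mx_continuous.
have dL : differentiable L (f x) by exact: linear_differentiable.
rewrite (deriveE _ (differentiable_comp df dL)) (deriveE _ df) (diff_comp df dL) /=.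
by rewrite (diff_lin _ cL).
Qed.

Lemma smooth_on_linear_mx (D : set V) (f : V -> 'M[R]_(a, b)) : open D ->
  smooth_on D f -> smooth_on D (L \o f).
Proof.
move=> oD sf k.
(* The derivative of L o f is known to be L o 'D_v f only on D, so the induction runs over all g
   that agree with L o f there. *)
suff H g : Ck k D f -> (forall x, D x -> g x = L (f x)) -> Ck k D g by exact: H.
elim: k f g {sf} => [|k IH] f g /= hf hg.
  move=> x Dx; have near_g : \forall y \near x, L (f y) = g y.
    by apply: filterS (open_nbhs_nbhs (conj oD Dx)) => y /hg.
  suff : g y @[y --> x] --> g x by [].
  rewrite (hg x Dx); apply: cvg_trans (near_eq_cvg near_g) _.
  by apply: (continuous_comp (hf x Dx)); exact: linear_mx_continuous.
have near_g x : D x -> \forall y \near x, (L \o f) y = g y.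
  by move=> Dx; apply: filterS (open_nbhs_nbhs (conj oD Dx)) => y /hg.
case: hf => df Df; split=> [x Dx|v].
  apply: near_eq_differentiable (near_g x Dx) _.
  apply: differentiable_comp; first exact: df.
  exact/linear_differentiable/linear_mx_continuous.
apply: IH (Df v) _ => x Dx; rewrite -derive_linear_mx; last exact: df.
by apply: near_eq_derive; apply: filterS (near_g x Dx).
Qed.

End SmoothMaps.

Section LinearForms.

Lemma form_at_injl (F : comUnitRingType) m (Om : 'M[F]_m) (u v : 'cV[F]_m) :
  Om \in unitmx -> (forall w, form_at Om u w = form_at Om v w) -> u = v.
Proof.
move=> hOm h; apply: trmx_inj; apply: (can_inj (mulmxK hOm)).
apply/rowP => j; have := h (delta_mx j 0).
by rewrite /form_at -!colE !mxE.
Qed.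

Lemma mulmx_cV_inj (F : pzRingType) m (A B : 'M[F]_m) :
  (forall v : 'cV[F]_m, A *m v = B *m v) -> A = B.
Proof.
move=> h; apply/matrixP => i j; have := h (delta_mx j 0).
by rewrite -!colE => /matrixP/(_ i 0); rewrite !mxE.
Qed.

(** Evaluation as a linear map of the Gram matrix, so that [smooth_on_linear_mx] applies to pairings
    of constant fields. *)
Definition form_eval (R : realType) m (u v : 'cV[R]_m) (Om : 'M[R]_m) : R^o :=
  form_at Om u v.

Lemma form_eval_linear (R : realType) m (u v : 'cV[R]_m) : linear (form_eval u v).
Proof.
move=> a A B; rewrite /form_eval /form_at mulmxDr mulmxDl mxE.
by rewrite -scalemxAr -scalemxAl mxE.
Qed.

HB.instance Definition _ (R : realType) m (u v : 'cV[R]_m) :=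
  GRing.isLinear.Build R 'M[R]_m R^o _ (form_eval u v) (form_eval_linear u v).

End LinearForms.

(** * Torsion, brackets and Nijenhuis tensors in a chart *)

Section ChartCalculus.
Import numFieldNormedType.Exports.
Local Open Scope classical_set_scope.

Variables (R : realType) (n : nat).
Local Notation vec := 'cV[R]_(4 * n).
Implicit Types (X Y Z : vec -> vec) (G : vec -> 'I_(4 * n) -> 'M[R]_(4 * n)).

Lemma torsionE G X Y p : torsion G X Y p = delta (G p) (X p) (Y p).
Proof.
rewrite /torsion /cov /bracket /delta.
move: ('D_(X p) Y p) ('D_(Y p) X p) (_ *m Y p) (_ *m X p) => a b c d.
by apply/matrixP => i j; rewrite !mxE; ring.
Qed.

Lemma bracketE G X Y p :
  bracket X Y p = cov G X Y p - cov G Y X p - delta (G p) (X p) (Y p).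
Proof. by rewrite -torsionE /torsion subKr. Qed.

Lemma cov_cst G (x y : vec) p :
  cov G (fun=> x) (fun=> y) p = contract (G p) x *m y.
Proof. by rewrite /cov derive_cst add0r. Qed.

Lemma bracket_cst (x y : vec) p : bracket (fun=> x) (fun=> y) p = 0.
Proof. by rewrite /bracket !derive_cst subrr. Qed.

(** Brackets are rewritten as covariant derivatives minus torsion. The derivatives cancel since J is
    parallel; the terms of delta(B) cancel since each B(u) commutes with J, whatever the dependence
    of B on u. *)
Lemma nijenhuis_eq0 G (J : vec -> 'M[R]_(4 * n)) X Y p
    (B : 'I_(4 * n) -> 'M[R]_(4 * n)) :
  J p *m J p = - 1%:M ->
  (forall u v, delta (G p) u v = delta B u v) ->
  (forall u, contract B u *m J p = J p *m contract B u) ->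
  (forall x, cov G (fun=> x) (apply_endo J X) p = J p *m cov G (fun=> x) X p) ->
  (forall x, cov G (fun=> x) (apply_endo J Y) p = J p *m cov G (fun=> x) Y p) ->
  nijenhuis J X Y p = 0.
Proof.
move=> hJ hB hC hX hY; rewrite /nijenhuis !(bracketE G) !hB.
have cJ U W : (forall x, cov G (fun=> x) (apply_endo J W) p = J p *m cov G (fun=> x) W p) ->
    cov G U (apply_endo J W) p = J p *m cov G U W p by move=> h; exact: h (U p).
have JJ (x : vec) : J p *m (J p *m x) = - x by rewrite mulmxA hJ mulNmx mul1mx.
have CJ u (x : vec) : contract B u *m (J p *m x) = J p *m (contract B u *m x).
  by rewrite !mulmxA hC.
rewrite !(cJ _ X) // !(cJ _ Y) // /delta /apply_endo !CJ.
rewrite !mulmxBr !JJ.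
move: (J p *m cov G _ Y p) (J p *m cov G _ X p) (cov G X Y p) (cov G Y X p) => a b c d.
move: (J p *m (_ *m Y p)) (J p *m (_ *m X p)) => a' b'.
move: (contract B (X p) *m Y p) (contract B (Y p) *m X p) => c' d'.
by apply/matrixP => i j; rewrite !mxE; ring.
Qed.

End ChartCalculus.

(** * The canonical connection *)

Section Manifold.
Import numFieldNormedType.Exports.
Local Open Scope classical_set_scope.

Variables (R : realType) (n : nat) (M : topologicalType) (S : smooth_atlas R M (4 * n)).
Local Notation vec := 'cV[R]_(4 * n).

Lemma vector_field_cst (i : chart S) (x : vec) : vector_field i (fun=> x).
Proof. exact: smooth_on_cst. Qed.

Lemma vector_field_endo_cst (J : endo_field S) i (x : vec) :
  vector_field i (apply_endo (J i) (fun=> x)).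
Proof.
exact: (smooth_on_linear_mx (mulmxr x) (@cod_open _ _ _ S i) (@endo_smooth _ _ _ S J i)).
Qed.

Lemma pairing_cst_differentiable (om : two_form S) i (x y : vec) p : cod i p ->
  differentiable (pairing (om i) (fun=> x) (fun=> y)) p.
Proof.
move=> hp; have := smooth_on_linear_mx (form_eval x y) (@cod_open _ _ _ S i) (@form_smooth _ _ _ S om i).
by move=> /(_ 1%N) [/(_ p hp)].
Qed.

Variables (J1 J2 J3 : endo_field S) (om : two_form S) (nabH nab : connection S).
Hypotheses (hH : almost_hypercomplex J1 J2 J3) (hom : scalar_form J1 J2 J3 om).
Hypotheses (hnabH : obata J1 J2 J3 nabH) (hnab : canonical_connection om nabH nab).

Lemma chart_quaternionic_form i p : cod i p ->
  quaternionic_form (J1 i p) (J2 i p) (J3 i p) (om i p).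
Proof.
move=> hp; have [a1 a2 _ a3] := hH; have [_ h1 h2 _] := hom.
have [e1 e2] := a3 i p hp.
split; split; [exact: a1|exact: a2|by []|by rewrite -e2 opprK| | |].
- apply/form_at_eqP => u v.
  by rewrite form_at_tr form_atN; exact: (form_skew om hp).
- by apply/form_at_eqP => u v; rewrite -form_at_mulr -form_at_mull h1.
- by apply/form_at_eqP => u v; rewrite -form_at_mulr -form_at_mull h2.
Qed.

Definition difference (i : chart S) (p : vec) (k : 'I_(4 * n)) : 'M[R]_(4 * n) :=
  nab i p k - nabH i p k.

Lemma cov_difference i p (X Y : vec -> vec) :
  cov (nab i) X Y p = cov (nabH i) X Y p + contract (difference i p) (X p) *m Y p.
Proof.
by rewrite /cov /difference contract_sub mulmxBl -addrA; congr (_ + _); rewrite addrC subrK.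
Qed.

Lemma delta_difference i p u v :
  delta (nab i p) u v = delta (nabH i p) u v + delta (difference i p) u v.
Proof.
have E w : contract (nab i p) w = contract (nabH i p) w + contract (difference i p) w.
  by rewrite /difference contract_sub addrC subrK.
by rewrite /delta !E !mulmxDl opprD addrACA.
Qed.

Lemma om_difference i p (X Y Z : vec -> vec) : cod i p ->
  vector_field i X -> vector_field i Y -> vector_field i Z ->
  form_at (om i p) (contract (difference i p) (X p) *m Y p) (Z p) =
  2%:R^-1 * cov_form (nabH i) (om i) X Y Z p.
Proof.
move=> hp hX hY hZ; rewrite -hnab // cov_difference.
by rewrite [X in form_at _ (X - _)]addrC addrK.
Qed.

Lemma om_difference_skew i p u v w : cod i p ->
  form_at (om i p) (contract (difference i p) u *m v) w =
  - form_at (om i p) (contract (difference i p) u *m w) v.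
Proof.
move=> hp.
have E y z := om_difference hp (vector_field_cst i u) (vector_field_cst i y)
  (vector_field_cst i z).
have := E v w; have := E w v => /= -> ->; rewrite -mulrN; congr (_ * _).
rewrite /cov_form /pairing !cov_cst.
(* Skewness of [om] holds only on [cod i], which is open: enough to compare derivatives at p. *)
have -> : 'D_u (pairing (om i) (fun=> v) (fun=> w)) p
        = - 'D_u (pairing (om i) (fun=> w) (fun=> v)) p.
  rewrite -deriveN; last exact/diff_derivable/pairing_cst_differentiable.
  apply: near_eq_derive; apply: filterS (open_nbhs_nbhs (conj (@cod_open _ _ _ S i) hp)) => q hq.
  exact: (form_skew om hq).
have hJ := chart_quaternionic_form hp.
by rewrite (om_skew hJ (_ *m v) w) (om_skew hJ v (_ *m w)); ring.
Qed.

(** [nabH] preserves J and [om] is J-Hermitian, so the covariant derivative of [om] is J-invariant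
    in its last two slots ([key]); nondegeneracy then moves J across A(u). *)
Lemma difference_commute (J : endo_field S) i p u : cod i p ->
  almost_complex J -> preserves nabH J -> hermitian om J ->
  contract (difference i p) u *m J i p = J i p *m contract (difference i p) u.
Proof.
move=> hp hJ pJ hm; have [/(_ i p hp) uOm _ _ _] := hom.
have key v w : form_at (om i p) (contract (difference i p) u *m (J i p *m v)) (J i p *m w) =
    form_at (om i p) (contract (difference i p) u *m v) w.
  have U := vector_field_cst i u.
  have /= -> := om_difference hp U (vector_field_endo_cst J i v) (vector_field_endo_cst J i w).
  have /= -> := om_difference hp U (vector_field_cst i v) (vector_field_cst i w).
  have D : 'D_u (pairing (om i) (apply_endo (J i) (fun=> v)) (apply_endo (J i) (fun=> w))) p
      = 'D_u (pairing (om i) (fun=> v) (fun=> w)) p.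
    apply: near_eq_derive.
    apply: filterS (open_nbhs_nbhs (conj (@cod_open _ _ _ S i) hp)) => q hq.
    exact: hm.
  rewrite /cov_form D /pairing !pJ //; try exact: vector_field_cst.
  by rewrite /apply_endo !hm.
apply (@mulmx_cV_inj R (4 * n)) => v; apply: (form_at_injl uOm) => w.
have -> : w = J i p *m - (J i p *m w).
  by rewrite mulmxN mulmxA hJ // mulNmx mul1mx opprK.
by rewrite -mulmxA key -mulmxA hm.
Qed.

Lemma difference_S2E i p k : cod i p ->
  S2E (J1 i p) (J2 i p) (J3 i p) (om i p) (difference i p k).
Proof.
move=> hp; have [a1 a2 a3 _] := hH; have [_ h1 h2 h3] := hom.
have [p1 p2 p3 _] := hnabH; rewrite -[difference i p k]contract_delta.
by split=> [|||u v]; [exact: difference_commute..|exact: om_difference_skew].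
Qed.

Lemma nab_endo (J : endo_field S) i p x X : cod i p -> vector_field i X ->
  almost_complex J -> preserves nabH J -> hermitian om J ->
  cov (nab i) (fun=> x) (apply_endo (J i) X) p = J i p *m cov (nab i) (fun=> x) X p.
Proof.
move=> hp hX hJ pJ hm; rewrite !cov_difference pJ //; last exact: vector_field_cst.
move: (cov (nabH i) (fun=> x) X p) => c.
by rewrite mulmxDr /apply_endo !mulmxA difference_commute.
Qed.

(** This says that [nab] preserves [om]: A supplies half of the derivative nabH om in each slot, the
    two halves agreeing by skewness. *)
Lemma derive_pairing i p (X Y Z : vec -> vec) : cod i p ->
  vector_field i X -> vector_field i Y -> vector_field i Z ->
  'D_(X p) (pairing (om i) Y Z) p =
  form_at (om i p) (cov (nab i) X Y p) (Z p) + form_at (om i p) (Y p) (cov (nab i) X Z p).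
Proof.
move=> hp hX hY hZ; rewrite !cov_difference form_atDl form_atDr.
rewrite (om_skew (chart_quaternionic_form hp) (Y p) (contract _ _ *m Z p)).
rewrite -(om_difference_skew (X p) (Y p) (Z p) hp) (om_difference hp hX hY hZ).
rewrite /cov_form /pairing.
by field.
Qed.

Lemma hypercomplex_symplectic_X57 : (0 < n)%N ->
  hypercomplex J1 J2 J3 /\ symplectic om -> type_X57 J1 J2 J3 om nab.
Proof.
move=> n0 [[i1 i2 i3] hs] i p hp.
have [_ _ _ hT] := hnabH; have hJ := chart_quaternionic_form hp.
have [/(_ i p hp) uOm _ _ _] := hom.
(* Integrability kills the torsion of the Obata connection. *)
have T0 u v : delta (nabH i p) u v = 0.
  have := hT i _ _ (vector_field_cst i u) (vector_field_cst i v) p hp.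
  rewrite torsionE => ->; rewrite i1 ?i2 ?i3 //; try exact: vector_field_cst.
  by rewrite !addr0 scaler0.
exists (delta (difference i p)); last first.
  by move=> X Y _ _; rewrite torsionE delta_difference T0 add0r.
apply: cyclic_sum_X57 => // [k|u v w]; first exact: difference_S2E.
have E x y z := om_difference hp (vector_field_cst i x) (vector_field_cst i y)
  (vector_field_cst i z).
(* Constant fields have vanishing brackets; as [nabH] is torsion-free, d om is the cyclic sum of
   nabH om, twice that of om(A(X,Y),Z). *)
have := hs i _ _ _ (vector_field_cst i u) (vector_field_cst i v) (vector_field_cst i w) p hp.
rewrite /ext_d /pairing !bracket_cst.
rewrite /cyclic_sum; have /= -> := E u v w; have /= -> := E v w u; have /= -> := E w u v.
rewrite /cov_form /pairing !cov_cst => hd.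
have z0 x : form_at (om i p) 0 x = 0 by rewrite -(scale0r 0) form_atZl mul0r.
have Tz x y z : form_at (om i p) (contract (nabH i p) x *m y) z
    = form_at (om i p) (contract (nabH i p) y *m x) z.
  by apply/eqP; rewrite -subr_eq0 -form_atBl -/(delta _ _ _) T0 z0.
move: hd; rewrite !z0 !subr0 (om_skew hJ v (_ *m w)) (om_skew hJ w (_ *m u)).
rewrite (om_skew hJ u (_ *m v)) (Tz u v) (Tz v w) (Tz w u) => hd.
by rewrite -mulrDr -mulrDr; apply/eqP; rewrite mulf_eq0; apply/orP; right;
  apply/eqP; rewrite -[RHS]hd; ring.
Qed.

Lemma X57_hypercomplex_symplectic :
  type_X57 J1 J2 J3 om nab -> hypercomplex J1 J2 J3 /\ symplectic om.
Proof.
move=> hT; have [a1 a2 a3 _] := hH; have [_ h1 h2 h3] := hom.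
have [p1 p2 p3 _] := hnabH.
have main i p : cod i p -> (forall u v w, pi_omega (om i p) (delta (nab i p)) u v w = 0) /\
    exists2 B, (forall u, S2E (J1 i p) (J2 i p) (J3 i p) (om i p) (contract B u)) &
      forall u v, delta (nab i p) u v = delta B u v.
  move=> hp; have [T hX hTE] := hT i p hp; have hJ := chart_quaternionic_form hp.
  (* Testing on constant fields turns the condition on vector fields into a pointwise one. *)
  have TE u v : delta (nab i p) u v = T u v.
    by rewrite -(hTE _ _ (vector_field_cst i u) (vector_field_cst i v)) torsionE.
  have [pT [B hB TB]] := X57_delta hJ hX.
  split=> [u v w|]; first by rewrite -[RHS](pT u v w) /pi_omega !TE.
  by exists B => [u|u v]; [exact: (S2E_contract hJ u hB)|rewrite TE].
split=> [|i X Y Z hX hY hZ p hp].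
  split=> i X Y hX hY p hp; have [_ [B hB BE]] := main i p hp.
  - apply: (nijenhuis_eq0 (a1 i p hp) BE) => [u|x|x]; [|exact: nab_endo..].
    by case: (hB u).
  - apply: (nijenhuis_eq0 (a2 i p hp) BE) => [u|x|x]; [|exact: nab_endo..].
    by case: (hB u).
  - apply: (nijenhuis_eq0 (a3 i p hp) BE) => [u|x|x]; [|exact: nab_endo..].
    by case: (hB u).
have [pT _] := main i p hp; rewrite -[RHS](pT (X p) (Y p) (Z p)).
have hJ := chart_quaternionic_form hp.
(* Since [nab] preserves [om], the covariant derivatives cancel in d om and only the torsion terms,
   [pi_omega], remain. *)
rewrite /ext_d !derive_pairing // /pairing /pi_omega !(bracketE (nab i)) !form_atBl.
rewrite (om_skew hJ (Y p) (cov _ _ _ _)) (om_skew hJ (Z p) (cov _ _ _ _)).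
by rewrite (om_skew hJ (X p) (cov _ _ _ _)); ring.
Qed.

End Manifold.

End Preliminaries.

Theorem theorem1p10 (R : realType) (n : nat) (hn : (1 < n)%N)
    (M : topologicalType) (hM : connected_manifold M)
    (S : smooth_atlas R M (4 * n))
    (J1 J2 J3 : endo_field S) (hH : almost_hypercomplex J1 J2 J3)
    (om : two_form S) (hom : scalar_form J1 J2 J3 om)
    (nabH : connection S) (hnabH : obata J1 J2 J3 nabH)
    (nab : connection S) (hnab : canonical_connection om nabH nab) :
  (hypercomplex J1 J2 J3 /\ symplectic om) <-> type_X57 J1 J2 J3 om nab.
Proof.
split; last exact: (X57_hypercomplex_symplectic hH hom hnabH hnab).
exact: (hypercomplex_symplectic_X57 hH hom hnabH hnab (ltnW hn)).
Qed.
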